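(* Let $\alpha\in(0,1)$, $\epsilon\in(0,1)$, and let $\mathcal{X}=\{\boldsymbol{x}\in\mathbb{R}^{n_x} : F_x\boldsymbol{x}\le g_x\}$ with $F_x\in\mathbb{R}^{r\times n_x}$, $g_x\in\mathbb{R}^r$. Let $\boldsymbol{x}_k$ be the state at step $k$ of the system $\boldsymbol{x}_{k+1}=A\boldsymbol{x}_k+B\boldsymbol{u}_k+D\boldsymbol{\delta}_k$ with deterministic initial state $\boldsymbol{x}_0$, deterministic inputs, and i.i.d. noise $\boldsymbol{\delta}_k$ drawn from a discrete distribution with $J$ outcomes and probability mass function $(p(1),\dots,p(J))$. If $$\mathbb{P}(\boldsymbol{x}_k\notin\mathcal{X})+\alpha\le\epsilon,$$ where $\mathbb{P}$ is the nominal probability, then $$\mathrm{TVD}_{1-\alpha}\big(\mathbf{1}_{\boldsymbol{x}_k\notin\mathcal{X}}\big)\le\epsilon.$$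
   Context: The state $\boldsymbol{x}_k$ is a function of the joint noise $(\boldsymbol{\delta}_0,\dots,\boldsymbol{\delta}_{k-1})$, which has $J^k$ outcomes with joint (nominal) probability mass function $p_k$; write $\boldsymbol{x}_k^j$ for the value of $\boldsymbol{x}_k$ at outcome $j\in\{1,\dots,J^k\}$. $\mathbf{1}_{\boldsymbol{x}_k\notin\mathcal{X}}$ is the indicator of the event $\boldsymbol{x}_k\notin\mathcal{X}$, so $\mathbb{P}(\boldsymbol{x}_k\notin\mathcal{X})=\sum_{j}p_k(j)\mathbf{1}_{\boldsymbol{x}_k^j\notin\mathcal{X}}$. TVD risk: for a random variable $C$ on a finite set of $M$ outcomes with nominal probability mass function $\pi$ and values $C^j$, $\mathrm{TVD}_{1-\alpha}(C)=\sup\{\sum_{j=1}^M q(j)C^j : q\in\mathbb{R}^M,\ q\ge0,\ \sum_j q(j)=1,\ \tfrac12\sum_j|q(j)-\pi(j)|\le\alpha\}$. In the claim it is taken with $M=J^k$ and $\pi=p_k$. *)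

(* Defs.v *)
From mathcomp Require Import all_boot all_order all_algebra.
From mathcomp Require Import boolp classical_sets reals numfun.

Set Implicit Arguments.
Unset Strict Implicit.
Unset Printing Implicit Defensive.

Import Order.TTheory GRing.Theory Num.Theory.

Local Open Scope classical_set_scope.
Local Open Scope ring_scope.

Section FiniteProbability.
Context {R : realType} {Omega : finType}.
Implicit Types (p q : Omega -> R) (E : set Omega) (C : Omega -> R).

Definition is_pmf p : Prop :=
  (forall w, 0 <= p w) /\ \sum_(w : Omega) p w = 1.

Definition expect p C : R := \sum_(w : Omega) p w * C w.

Definition prob p E : R := expect p \1_E.

Definition tv_dist q p : R := 2^-1 * \sum_(w : Omega) `|q w - p w|.

(* [tvd_risk alpha pi C] is TVD_{1-alpha}(C) with nominal pmf [pi]: the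
   subscript is the confidence level, the argument is the ball radius. *)
Definition tvd_risk (alpha : R) (pi : Omega -> R) C : R :=
  sup [set expect q C | q in [set q | is_pmf q /\ tv_dist q pi <= alpha]].

(* [sup] takes a default value on empty or unbounded sets; this case does not
   occur in [tvd_risk]. *)
Lemma tvd_risk_has_sup (alpha : R) (pi : Omega -> R) C :
  0 <= alpha -> is_pmf pi ->
  has_sup [set expect q C | q in [set q | is_pmf q /\ tv_dist q pi <= alpha]].
Proof.
move=> alpha0 pi_pmf; split.
  exists (expect pi C), pi => //; split=> //.
  by rewrite /tv_dist big1 ?mulr0 // => w _; rewrite subrr normr0.
exists (\sum_(w : Omega) `|C w|) => _ [q [[q0 q1] _] <-].
apply: ler_sum => w _; apply: (le_trans (ler_norm _)).
rewrite normrM (ger0_norm (q0 w)) ler_piMl // -q1 (bigD1 w) //= lerDl.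
by apply: sumr_ge0.
Qed.

End FiniteProbability.

(* An outcome of the joint noise (delta_0, ..., delta_{k-1}) selects one of the
   J noise values at each step, so there are J ^ k of them. *)
Notation noise_path J k := {ffun 'I_k -> 'I_J}.

(* Independent, identically distributed noise: the joint pmf is the product. *)
Definition joint_pmf {R : realType} {J : nat} (p : 'I_J -> R) (k : nat)
    (w : noise_path J k) : R :=
  \prod_(t < k) p (w t).

Definition noise_prefix {J k : nat} (w : noise_path J k.+1) : noise_path J k :=
  [ffun t : 'I_k => w (widen_ord (leqnSn k) t)].

(* [d j] is the j-th value of the discrete noise distribution. *)
Fixpoint state {R : realType} {nx nu nd J : nat}
    (A : 'M[R]_nx) (B : 'M[R]_(nx, nu)) (D : 'M[R]_(nx, nd))
    (x0 : 'cV[R]_nx) (u : nat -> 'cV[R]_nu) (d : 'I_J -> 'cV[R]_nd)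
    (k : nat) : noise_path J k -> 'cV[R]_nx :=
  match k return noise_path J k -> 'cV[R]_nx with
  | 0 => fun _ => x0
  | k'.+1 => fun w =>
      A *m state A B D x0 u d (noise_prefix w) + B *m u k'
      + D *m d (w ord_max)
  end.

Definition polyhedron {R : realType} {r nx : nat}
    (F : 'M[R]_(r, nx)) (g : 'cV[R]_r) : set 'cV[R]_nx :=
  [set x | forall i, (F *m x) i 0 <= g i 0].

(* Main.v *)
Require Import Defs.
From mathcomp Require Import all_boot all_order all_algebra.
From mathcomp Require Import boolp classical_sets reals numfun.
From mathcomp Require Import lra.

Set Implicit Arguments.
Unset Strict Implicit.
Unset Printing Implicit Defensive.

Import Order.TTheory GRing.Theory Num.Theory.

Local Open Scope classical_set_scope.
Local Open Scope ring_scope.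

(** Constraint violation is an event on the noise paths, and passing to another distribution changes
    the probability of an event by at most the total variation distance ([prob_le_tv_dist]). So
    every distribution in the ball of radius [alpha] around the joint pmf gives violation at most
    its nominal probability plus [alpha], and the supremum inherits this bound. *)

Lemma is_pmf_joint (R : realType) (J : nat) (p : 'I_J -> R) (k : nat) :
  is_pmf p -> is_pmf (joint_pmf p (k := k)).
Proof.
move=> [p0 p1]; split=> [w|]; first exact: prodr_ge0.
(* Distributivity: the sum over paths factors into one sum of [p] per time step, each equal to 1. *)
by rewrite -(bigA_distr_bigA (fun=> p)) big1.
Qed.

(* Since [q - p] has total mass 0, the sum of its positive parts is
   [tv_dist q p], and it dominates the sum of [q - p] over any event. *)
Lemma prob_le_tv_dist (R : realType) (Omega : finType) (q p : Omega -> R)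
    (E : set Omega) :
  is_pmf q -> is_pmf p -> prob q E <= prob p E + tv_dist q p.
Proof.
move=> [_ q1] [_ p1].
have mass0 : \sum_w (q w - p w) = 0 by rewrite sumrB q1 p1 subrr.
rewrite -lerBlDl /prob /expect -sumrB /tv_dist.
(* Adding the zero mass makes each right-hand term [(t + |t|) / 2] with [t = q w - p w], the
   positive part of [t], so the comparison becomes termwise. *)
rewrite -[X in _ * X]add0r -[X in _ * (X + _)]mass0 -big_split mulr_sumr.
apply: ler_sum => w _ /=; rewrite indicE -mulrBl.
have := ler_norm (q w - p w); have := ler_norm (- (q w - p w)).
by rewrite normrN; case: (_ \in _) => /=; lra.
Qed.

Lemma tvd_risk_indic_le (R : realType) (Omega : finType) (alpha : R)
    (pi : Omega -> R) (E : set Omega) :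
  0 <= alpha -> is_pmf pi -> tvd_risk alpha pi \1_E <= prob pi E + alpha.
Proof.
move=> alpha0 pi_pmf; apply: ge_sup.
  (* An upper bound on the elements bounds [sup] once the set is nonempty; here [pi] itself lies in
     the ball. *)
  by have [] := tvd_risk_has_sup \1_E alpha0 pi_pmf.
move=> _ [q [q_pmf q_close] <-].
by apply: (le_trans (prob_le_tv_dist E q_pmf pi_pmf)); rewrite lerD2l.
Qed.

Theorem lemma1 (R : realType) (nx nu nd r J : nat) (alpha epsilon : R)
    (halpha : 0 < alpha < 1) (hepsilon : 0 < epsilon < 1)
    (Fx : 'M[R]_(r, nx)) (gx : 'cV[R]_r)
    (A : 'M[R]_nx) (B : 'M[R]_(nx, nu)) (D : 'M[R]_(nx, nd))
    (x0 : 'cV[R]_nx) (u : nat -> 'cV[R]_nu)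
    (d : 'I_J -> 'cV[R]_nd) (p : 'I_J -> R) (hp : is_pmf p) (k : nat) :
  let X := polyhedron Fx gx in
  let xk := @state R nx nu nd J A B D x0 u d k in
  let violation := [set w | ~ X (xk w)] in
  prob (joint_pmf p (k := k)) violation + alpha <= epsilon ->
  tvd_risk alpha (joint_pmf p (k := k)) (\1_violation) <= epsilon.
Proof.
move=> X xk violation; apply: le_trans.
apply: tvd_risk_indic_le; last exact: is_pmf_joint.
by case/andP: halpha => /ltW.
Qed.
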